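(* Consider the job-based flow-time-plus-energy problem described in the context, in which all jobs are released at time $0$, the power function $P$ satisfies the stated power-function assumption, and the many-jobs scaling assumption holds. Then the job-SRPT algorithm with the speed rule $$s_k(t)=\begin{cases}P^{-1}\!\left(\frac{n(t)}{K}\right) & \text{if } n(t)\ge K,\\ P^{-1}(1) & \text{otherwise,}\end{cases}\qquad k=1,\dots,K,$$ (where $n(t)$ is the number of unfinished jobs at time $t$) has competitive ratio at most $$P\!\left(2-\tfrac{1}{K}\right)\left(2+\frac{2}{P^{-1}(1)}\max\bigl(1,P(\bar s)\bigr)\right)+o(1),$$ where $\bar s=\inf\{s>0: P(s)>s\}$ and the $o(1)$ term vanishes under the many-jobs scaling.
   Context: Model: there are $K$ identical servers. Server $k$ runs at time $t$ at a chosen speed $s_k(t)\ge 0$ (work processed per unit time) and consumes power $P(s_k(t))$. A finite set $\mathcal J$ of $\mathsf J$ jobs is given; job $i$ is released at time $a_i$ and consists of $m_i$ map tasks with sizes (work) $\mathsf m_{i1},\dots,\mathsf m_{im_i}$ and $r_i$ reduce tasks with sizes $\mathsf r_{i1},\dots,\mathsf r_{ir_i}$. Precedence (MapReduce) constraint: a reduce task of job $i$ may be processed only after all $m_i$ map tasks of job $i$ are completed. Preemption and migration are allowed, but a task cannot be processed on two servers simultaneously. A task is free at time $t$ if it may be processed at $t$ (map tasks are always free; a reduce task is free once all map tasks of its job are completed). The flow time of job $i$ is $T_i-a_i$ where $T_i$ is the completion time of the last task of job $i$. The job-based cost of a schedule is $C_{\text{job}}=\int n(t)\,dt+\int\sum_{k=1}^K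 P(s_k(t))\,dt$, where $n(t)$ is the number of unfinished jobs at time $t$. An online algorithm learns about job $i$ only at time $a_i$. The competitive ratio of an algorithm $A$ is $\sup_\sigma C^A(\sigma)/C^{\mathsf{OPT}}(\sigma)$ over inputs $\sigma$, where $\mathsf{OPT}$ is the minimum cost over all feasible schedules (choice of tasks and speeds) with full knowledge of the input. Power-function assumption: $P:\mathbb R_+\to\mathbb R_+$, $P(0)=0$, $P$ is differentiable, strictly increasing and strictly convex, $\bar s:=\inf\{s>0:P(s)>s\}<\infty$, $P(xy)\le P(x)P(y)$ for $x,y>0$, and $\Delta(x):=P'(P^{-1}(x))=o(x)$ as $x\to\infty$. Many-jobs scaling assumption: letting $w_j$ be the total size (sum of all map and reduce task sizes) of job $j$ and $w_{\max}=\max_j w_j$, the number of jobs $\mathsf J$ is large and $K\,w_{\max}\,\Delta(\mathsf J/K)=o\bigl(\sum_{j=1}^{\mathsf J}w_j\bigr)$. Job-SRPT algorithm: the cumulative remaining work of a job at time $t$ is the sum of the remaining sizes of all its (map and reduce) tasks. Order the $n(t)$ unfinished jobs by increasing cumulative remaining work. If $n(t)\ge K$, the $K$ jobs with smallest cumulative remaining work are processed, one per server, and each such server processes the shortest (smallest remaining size) free task of its job. If $n(t)<K$, each of the $n(t)$ jobs has its shortest free task processed on a distinct server, and the remaining $K-n(t)$ servers process the $K-n(t)$ shortest free tasks (among those not already being processed) across all unfinished jobs.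
   Formalization: The speed rule is applied only to servers that are processing a task; a server with no task runs at speed 0, since the literal rule P^{-1}(1) for n(t)<K would consume infinite energy after all jobs finish. *)

(* Defs.v *)
From HB Require Import structures.
From mathcomp Require Import all_boot all_order all_algebra.
From mathcomp Require Import all_classical all_reals all_analysis.
Unset Printing Implicit Defensive.
Import Order.TTheory GRing.Theory Num.Theory.
Import numFieldNormedType.Exports.
Local Open Scope classical_set_scope.
Local Open Scope ring_scope.

Definition sbar {R : realType} (P : R -> R) : R := inf [set s | 0 < s /\ s < P s].

Definition Delta {R : realType} (P Pinv : R -> R) (x : R) : R := derive1 P (Pinv x).

Definition power_assumption {R : realType} (P Pinv : R -> R) : Prop :=
  [/\ P 0 = 0,
      (forall x, 0 <= x -> 0 <= P x),
      (forall x, 0 < x -> derivable P x 1) &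
      (forall x y, 0 <= x -> x < y -> P x < P y)] /\
  [/\
      (forall x y (l : R), 0 <= x -> 0 <= y -> x != y -> 0 < l < 1 ->
          P (l * x + (1 - l) * y) < l * P x + (1 - l) * P y),
      (exists s, 0 < s /\ s < P s) (* sbar < +oo *),
      (forall x y, 0 < x -> 0 < y -> P (x * y) <= P x * P y) &
      (forall x, 0 <= x -> 0 <= Pinv x /\ P (Pinv x) = x)] /\
      (forall eps, 0 < eps -> exists M, forall x, M <= x ->
          `|Delta P Pinv x| <= eps * x).

(* Instances: all jobs released at time 0.                              *)
(* Tasks form a finite type; each task belongs to a job, is a map task  *)
(* (ismap = true) or a reduce task (ismap = false), and has a size.     *)

Record instance (R : realType) := Instance {
  njobs : nat;
  task : finType;
  job : task -> 'I_njobs;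
  ismap : task -> bool;
  tsize : task -> R }.
Arguments njobs {R} i.
Arguments task {R} i.
Arguments job {R} i _.
Arguments ismap {R} i _.
Arguments tsize {R} i _.

Definition wf_instance {R : realType} (I : instance R) : Prop :=
  (forall x, 0 < tsize I x) /\ (forall i : 'I_(njobs I), exists x, job I x = i).

Definition jsize {R : realType} (I : instance R) (j : 'I_(njobs I)) : R :=
  \sum_(x : task I | job I x == j) tsize I x.

Definition wmax {R : realType} (I : instance R) : R :=
  \big[Num.max/0]_(j : 'I_(njobs I)) jsize I j.

Definition wtot {R : realType} (I : instance R) : R :=
  \sum_(j : 'I_(njobs I)) jsize I j.

Record schedule (R : realType) (K : nat) (T : Type) := Schedule {
  speed : 'I_K -> R -> R;
  assign : 'I_K -> R -> option T  (* task processed by server k at t, if any *) }.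
Arguments speed {R K T} s _ _.
Arguments assign {R K T} s _ _.

Section Sched.
Context {R : realType} (P : R -> R) (K : nat) (I : instance R).
Local Notation T := (task I).
Local Notation sched := (schedule R K T).
Let leb := (@lebesgue_measure R).
Definition upto (t : R) : set R := [set u : R | 0 <= u <= t].
Definition nonneg_times : set R := [set u : R | 0 <= u].

Definition rate (S : sched) (x : T) (u : R) : R :=
  \sum_(k < K) (if assign S k u == Some x then speed S k u else 0).

Definition work (S : sched) (x : T) (t : R) : \bar R :=
  (\int[leb]_(u in upto t) (rate S x u)%:E)%E.

Definition finished (S : sched) (x : T) (t : R) : bool :=
  ((tsize I x)%:E <= work S x t)%E.

Definition unfinished (S : sched) (x : T) (t : R) : bool := ~~ finished S x t.

Definition rem (S : sched) (x : T) (t : R) : \bar R :=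
  ((tsize I x)%:E - work S x t)%E.

Definition free (S : sched) (x : T) (t : R) : bool :=
  unfinished S x t &&
  (ismap I x || [forall y, ((job I y == job I x) && ismap I y) ==> finished S y t]).

Definition unfinished_jobs (S : sched) (t : R) : {set 'I_(njobs I)} :=
  [set i | [exists x, (job I x == i) && unfinished S x t]].

Definition nunf (S : sched) (t : R) : nat := #|unfinished_jobs S t|.

Definition jrem (S : sched) (i : 'I_(njobs I)) (t : R) : \bar R :=
  (\sum_(x : T | (job I x == i) && unfinished S x t) rem S x t)%E.

(* feasibility (all jobs released at 0, so only t >= 0 matters) *)
Definition feasible (S : sched) : Prop :=
  [/\ (forall k u, 0 <= speed S k u),
      (forall k, measurable_fun setT (speed S k)),
      (forall k (x : T), measurable (assign S k @^-1` [set Some x])),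
      (forall k k' u (x : T), 0 <= u -> k != k' ->
          assign S k u = Some x -> assign S k' u <> Some x) &
      (forall k u (x : T), 0 <= u -> assign S k u = Some x -> ismap I x = false ->
          forall y, job I y = job I x -> ismap I y -> finished S y u)].

Definition cost (S : sched) : \bar R :=
  ((\int[leb]_(u in nonneg_times) ((nunf S u)%:R)%:E) +
   (\int[leb]_(u in nonneg_times) (\sum_(k < K) P (speed S k u))%:E))%E.

Definition OPT : \bar R := ereal_inf [set cost S | S in [set S : sched | feasible S]].

Definition shortest_free_in_job (S : sched) (x : T) (t : R) : Prop :=
  free S x t /\
  forall y, job I y = job I x -> free S y t -> (rem S x t <= rem S y t)%E.

Definition srpt_at (Pinv : R -> R) (S : sched) (t : R) : Prop :=
  let U := unfinished_jobs S t in
  let n := nunf S t in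
  if (K <= n)%N then
    exists Sel : {set 'I_(njobs I)},
      [/\ Sel \subset U, #|Sel| = K,
          (forall i j, i \in Sel -> j \in U :\: Sel -> (jrem S i t <= jrem S j t)%E),
          (forall k, exists x, [/\ assign S k t = Some x, job I x \in Sel,
                                  shortest_free_in_job S x t &
                                  speed S k t = Pinv (n%:R / K%:R)]) &
          (forall k k' x x', assign S k t = Some x -> assign S k' t = Some x' ->
              job I x = job I x' -> k = k')]
  else
    exists B1 : {set 'I_K},
      [/\ #|B1| = n,
          (forall k, k \in B1 -> exists x, assign S k t = Some x /\
                                          shortest_free_in_job S x t),
          (forall k k' x x', k \in B1 -> k' \in B1 ->
              assign S k t = Some x -> assign S k' t = Some x' ->
              job I x = job I x' -> k = k') &
          [/\ (forall k x, k \notin B1 -> assign S k t = Some x ->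
              free S x t /\
              forall y, free S y t -> (forall k', assign S k' t <> Some y) ->
                 (rem S x t <= rem S y t)%E),
          (forall k, k \notin B1 -> assign S k t = None ->
              forall y, free S y t -> exists k', assign S k' t = Some y) &
          (forall k, speed S k t = if assign S k t is Some _ then Pinv 1 else 0)]].

Definition job_srpt (Pinv : R -> R) (S : sched) : Prop :=
  forall t, 0 <= t -> srpt_at Pinv S t.

End Sched.

(* Main.v *)
From HB Require Import structures.
From mathcomp Require Import all_boot all_order all_algebra.
From mathcomp Require Import all_classical all_reals all_analysis.
From mathcomp Require Import measurable_realfun ring lra.
Require Import Defs.
Import Order.TTheory GRing.Theory Num.Theory.
Import numFieldNormedType.Exports.
Local Open Scope classical_set_scope.
Local Open Scope ring_scope.

(** By convexity, a server running at speed [s] while [n] jobs are unfinished satisfies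
    [s * g n <= n / K + P s] with [g n := (n / K) / Pinv (n / K)]: work done then costs at
    least [g n] per unit. Since [g] is nondecreasing, summation by layers turns this into
    a lower bound on the cost of any feasible schedule, the sum over [m] of
    [g (m + 1) - g m] times the least total size of [J - m] jobs, because at least that
    much work is done before at most [m] jobs are left.

    Job-SRPT pays exactly [2 * g n] per unit of work while [n >= K]. It never reverses the
    order of the remaining works of two unfinished jobs, so the finished jobs are always
    the smallest ones, and at most [K] unfinished jobs have ever been served. Hence the
    work done while more than [m] jobs are unfinished exceeds the least possible one by at
    most [K * wmax]. The work done once [n < K] is also at most [K * wmax]. As
    [g J <= Delta (J / K)], the excess is negligible under the many-jobs scaling, so the
    ratio is in fact at most [2 + o(1)]. *)

Section Power.
Context {R : realType} (P Pinv : R -> R) (hP : power_assumption P Pinv).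

Lemma power0 : P 0 = 0. Proof. by case: hP => -[]. Qed.
Let P_lt x y : 0 <= x -> x < y -> P x < P y.
Proof. by case: hP => -[_ _ _ h] _; exact: h. Qed.
Lemma PinvK x : 0 <= x -> P (Pinv x) = x.
Proof. by case: hP => _ [[_ _ _ h] _] /h[]. Qed.

Lemma power_ge0 x : 0 <= x -> 0 <= P x.
Proof. by case: hP => -[_ h _ _] _; exact: h. Qed.

Lemma power_le x y : 0 <= x -> x <= y -> P x <= P y.
Proof.
by move=> x0; rewrite le_eqVlt => /predU1P[->//|/(P_lt _ _ x0)/ltW].
Qed.

Lemma power_gt0 x : 0 < x -> 0 < P x.
Proof. by move=> x0; rewrite -power0; exact: P_lt. Qed.

Lemma Pinv_ge0 x : 0 <= x -> 0 <= Pinv x.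
Proof. by case: hP => _ [[_ _ _ h] _] /h[]. Qed.

Lemma Pinv_gt0 x : 0 < x -> 0 < Pinv x.
Proof.
move=> x0; rewrite lt_neqAle Pinv_ge0 ?(ltW x0)// andbT.
by apply/eqP => e; move: (PinvK x (ltW x0)); rewrite -e power0 => xE; rewrite xE ltxx in x0.
Qed.

Lemma Pinv_le x y : 0 <= x -> x <= y -> Pinv x <= Pinv y.
Proof.
move=> x0 xy; rewrite leNgt; apply/negP => /P_lt.
rewrite !PinvK ?Pinv_ge0 ?(le_trans x0 xy)// => /(_ isT).
by rewrite ltNge xy.
Qed.

Lemma power_scale x y : 0 < x -> 0 <= y -> y <= x -> P y * x <= P x * y.
Proof.
move=> x0; rewrite le_eqVlt => /predU1P[<-|y0]; first by rewrite power0 mul0r mulr0.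
rewrite le_eqVlt => /predU1P[->//|yx].
have cvx : forall x y (l : R), 0 <= x -> 0 <= y -> x != y -> 0 < l < 1 ->
    P (l * x + (1 - l) * y) < l * P x + (1 - l) * P y by case: hP => _ [[]].
have := cvx x 0 (y / x) (ltW x0) (lexx _).
rewrite power0 !mulr0 !addr0 divfK ?gt_eqF// divr_gt0//= ltr_pdivrMr// mul1r.
move=> /(_ isT yx)/ltW; rewrite mulrAC ler_pdivlMr//.
by rewrite [P x * y]mulrC.
Qed.

Lemma young_power s x : 0 <= s -> 0 <= x -> s * (x / Pinv x) <= x + P s.
Proof.
move=> s0; rewrite le_eqVlt => /predU1P[<-|x0].
  by rewrite mul0r mulr0 add0r; exact: power_ge0.
have p0 := Pinv_gt0 x x0.
rewrite mulrA ler_pdivrMr//.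
have [sp|/ltW ps] := leP s (Pinv x).
  rewrite mulrDl (le_trans (ler_wpM2r (ltW x0) sp))// [x * _]mulrC lerDl.
  by apply: mulr_ge0; [exact: power_ge0|exact: ltW].
have := power_scale s (Pinv x) (lt_le_trans p0 ps) (ltW p0) ps.
rewrite PinvK ?(ltW x0)// mulrC => /le_trans; apply.
by rewrite ler_pM2r// lerDr ltW.
Qed.

Lemma marginal_le x y : 0 <= x -> x <= y -> x / Pinv x <= y / Pinv y.
Proof.
rewrite le_eqVlt => /predU1P[<- y0|x0 xy].
  by rewrite mul0r divr_ge0 ?Pinv_ge0.
have y0 := lt_le_trans x0 xy.
rewrite ler_pdivrMr ?Pinv_gt0// mulrAC ler_pdivlMr ?Pinv_gt0//.
have := power_scale _ _ (Pinv_gt0 y y0) (ltW (Pinv_gt0 x x0)) (Pinv_le x y (ltW x0) xy).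
by rewrite !PinvK ?(ltW x0) ?(ltW y0).
Qed.

Lemma marginal_le_Delta x : 0 < x -> x / Pinv x <= Delta P Pinv x.
Proof.
move=> x0; have p0 := Pinv_gt0 x x0; rewrite /Delta; set p := Pinv x in p0 *.
have Px : P p = x by rewrite PinvK ?ltW.
have dP : derivable P p 1 by case: hP => -[_ _ h _] _; exact: h.
rewrite derive1E; apply: limr_ge; first exact: dP.
near=> h.
have h0 : h != 0 by near: h; exact: nbhs_dnbhs_neq.
have hp : `|h| < p by near: h; exact: dnbhs0_lt.
have ph0 : 0 < p + h by move: hp; rewrite ltr_norml => /andP[+ _]; lra.
rewrite /= [h%:A]mulr1 [h + p]addrC -/p /GRing.scale/=.
rewrite Px [leRHS]mulrC.
have [hn|hpos] := ltrP h 0.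
  have := power_scale p (p + h) p0 (ltW ph0); rewrite Px => /(_ ltac:(lra)) H.
  have -> : (P (p + h) - x) / h = (x - P (p + h)) / - h.
    by rewrite invrN mulrN -mulNr opprB.
  rewrite ler_pdivlMr ?oppr_gt0//.
  rewrite mulrAC ler_pdivrMr//.
  nra.
have h1 : 0 < h by rewrite lt_def h0.
rewrite ler_pdivlMr// mulrAC ler_pdivrMr//.
have := power_scale (p + h) p ph0 (ltW p0); rewrite Px => /(_ ltac:(lra)) H.
nra.
Unshelve. all: by end_near. Qed.

Lemma power_ge1 x : 1 <= x -> 1 <= P x.
Proof.
move=> x1; apply: le_trans (power_le 1 x ler01 x1).
have P1 := power_gt0 1 ltr01.
case: hP => _ [[_ _ h _] _]; have := h 1 1 ltr01 ltr01.
by rewrite mulr1 -{1}[P 1]mulr1 ler_pM2l.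
Qed.

Lemma speed_le_power : exists2 c : R, 0 <= c & forall s, 0 <= s -> s <= c + P s.
Proof.
have [s [s0 sP]] : exists s, 0 < s /\ s < P s by case: hP => _ [[]].
exists s; first exact: ltW.
move=> x x0; have [xs|/ltW sx] := leP x s; first by rewrite ler_wpDr ?power_ge0.
suff : x <= P x by have := s0; lra.
have := power_scale x s (lt_le_trans s0 sx) (ltW s0) sx.
have Px := power_ge0 x x0; nra.
Qed.

End Power.

Section Primitive.
Context {R : realType}.
Local Notation mu := (@lebesgue_measure R).
Implicit Types (f g : R -> R) (t a b c : R) (D : set R).

Definition locally_finite f := [/\ measurable_fun setT f, (forall u, 0 <= f u) &
  forall t, (\int[mu]_(u in upto t) (f u)%:E < +oo)%E].

Definition prim f t : R := fine (\int[mu]_(u in upto t) (f u)%:E).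

Lemma uptoE t : upto t = `[0, t]%classic.
Proof. by apply/seteqP; split => u /=; rewrite in_itv. Qed.

Lemma measurable_upto t : measurable (upto t).
Proof. by rewrite uptoE. Qed.

Lemma nonneg_timesE : @nonneg_times R = `[0, +oo[%classic.
Proof. by apply/seteqP; split => u /=; rewrite in_itv/= andbT. Qed.

Lemma measurable_nonneg_times : measurable (@nonneg_times R).
Proof. by rewrite nonneg_timesE. Qed.

Lemma primE f t : locally_finite f ->
  (prim f t)%:E = (\int[mu]_(u in upto t) (f u)%:E)%E.
Proof.
move=> [mf f0 fi]; rewrite fineK// ge0_fin_numE//.
by apply: integral_ge0 => u _; rewrite lee_fin.
Qed.

Lemma prim_le0 f t : t <= 0 -> prim f t = 0.
Proof.
move=> t0; rewrite /prim uptoE.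
have [t1|t1] := ltP t 0; first by rewrite set_itv_ge ?integral_set0//= bnd_simp -ltNge.
have -> : t = 0 by apply/eqP; rewrite eq_le t0.
by rewrite set_itv1 integral_set1.
Qed.

Lemma prim_ge0 f t : locally_finite f -> 0 <= prim f t.
Proof.
move=> lf; rewrite -lee_fin primE//.
by apply: integral_ge0 => u _; rewrite lee_fin; case: lf.
Qed.

Lemma prim_itv f a b : locally_finite f -> 0 <= a -> a <= b ->
  (\int[mu]_(u in `]a, b[) (f u)%:E = (prim f b - prim f a)%:E)%E.
Proof.
move=> lf a0 ab; have [mf f0 fi] := lf.
have mfE D : measurable_fun D (fun u => (f u)%:E).
  by apply/measurable_EFinP; exact: measurable_funS mf.
rewrite EFinB !primE// !uptoE (@itv_bndbnd_setU _ _ (BLeft 0) (BRight a))//=.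
rewrite ge0_integral_setU//=.
- rewrite addeAC subee ?add0e; last first.
    by rewrite -uptoE ge0_fin_numE// integral_ge0// => u _; rewrite lee_fin.
  by rewrite [RHS]integral_itv_bndoo//; exact: mfE.
- exact: mfE.
- by move=> u _; rewrite lee_fin.
- apply/disj_setPLR => u /=; rewrite !in_itv/= => /andP[_ ua].
  by apply/negP; rewrite negb_and -leNgt ua.
Qed.

Lemma prim_nd f a b : locally_finite f -> a <= b -> prim f a <= prim f b.
Proof.
move=> lf ab; have [a0|a0] := leP 0 a; last first.
  by rewrite (prim_le0 _ _ (ltW a0)); exact: prim_ge0.
rewrite -subr_ge0 -lee_fin -prim_itv//.
by apply: integral_ge0 => u _; rewrite lee_fin; case: lf.
Qed.

Lemma prim_diff_le f g a b : locally_finite f -> locally_finite g ->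
  0 <= a -> a <= b -> (forall u, a < u < b -> f u <= g u) ->
  prim f b - prim f a <= prim g b - prim g a.
Proof.
move=> lf lg a0 ab fg; rewrite -lee_fin -!prim_itv//.
have [mf f0 _] := lf; have [mg g0 _] := lg.
apply: ge0_le_integral => //=.
- by move=> u _; rewrite lee_fin.
- by apply/measurable_EFinP; exact: measurable_funS mf.
- by apply/measurable_EFinP; exact: measurable_funS mg.
Qed.


Lemma locally_finite_sum (I : finType) (A : pred I) (F : I -> R -> R) :
  (forall i, locally_finite (F i)) -> locally_finite (fun u => \sum_(i | A i) F i u).
Proof.
move=> lF; split.
- under eq_fun do rewrite big_mkcond/=.
  by apply: measurable_sum => i; case: (A i) => //; case: (lF i).
- by move=> u; apply: sumr_ge0 => i _; case: (lF i).
- move=> t; under eq_integral do rewrite -sumEFin big_mkcond/=.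
  rewrite ge0_integral_sum//=; last 3 first.
  + exact: measurable_upto.
  + move=> i; case: (A i) => //; apply/measurable_EFinP; case: (lF i) => mF _ _.
    exact: measurable_funS mF.
  + by move=> i u _; case: (A i); rewrite lee_fin//; case: (lF i).
  apply: lte_sum_pinfty => i _; case: (A i); first by case: (lF i).
  by rewrite integral0.
Qed.

Lemma prim_sum (I : finType) (A : pred I) (F : I -> R -> R) t :
  (forall i, locally_finite (F i)) ->
  prim (fun u => \sum_(i | A i) F i u) t = \sum_(i | A i) prim (F i) t.
Proof.
move=> lF; apply/EFin_inj; rewrite primE; last exact: locally_finite_sum.
rewrite -sumEFin [RHS]big_mkcond/=.
under eq_integral do rewrite -sumEFin big_mkcond/=.
rewrite ge0_integral_sum//=.
- apply: eq_bigr => i _; case: (A i); first by rewrite primE.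
  by rewrite integral0.
- exact: measurable_upto.
- move=> i; case: (A i) => //; apply/measurable_EFinP; case: (lF i) => mF _ _.
  exact: measurable_funS mF.
- by move=> i u _; case: (A i); rewrite lee_fin//; case: (lF i).
Qed.

Let nn f := f \_ (@nonneg_times R).

Let prim_nn f a t : a <= 0 ->
  (\int[mu]_(u in `[a, t]) (nn f u)%:E = \int[mu]_(u in upto t) (f u)%:E)%E.
Proof.
move=> a0; have -> : upto t = `[a, t]%classic `&` @nonneg_times R.
  apply/seteqP; split => u /=; rewrite in_itv/= /nonneg_times /upto/=.
    by move=> /andP[u0 ->]; rewrite (le_trans a0 u0).
  by case=> /andP[_ ->] ->.
by rewrite integral_mkcondr; apply: eq_integral => u _; rewrite /nn !patchE; case: ifP.
Qed.

Let integrable_nn f a t : locally_finite f -> a <= 0 ->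
  mu.-integrable `[a, t] (EFin \o nn f).
Proof.
move=> [mf f0 fi] a0.
have mnn : measurable_fun setT (nn f).
  apply/(measurable_restrictT _ _).1; first exact: measurable_nonneg_times.
  exact: measurable_funS mf.
apply/integrableP; split.
  by apply/measurable_EFinP; exact: measurable_funS mnn.
under eq_integral => u _.
  have nn0 : 0 <= nn f u by rewrite /nn patchE; case: ifP.
  rewrite gee0_abs ?lee_fin//; over.
by rewrite prim_nn.
Qed.

Lemma prim_continuous f : locally_finite f -> continuous (prim f).
Proof.
move=> lf t; pose c := `|t| + 1.
have c0 : 0 < c by rewrite ltr_wpDl.
have tc : - c < t < c by rewrite -ltr_norml ltrDl.
have cc : - c < c by lra.
have nc0 : - c <= 0 by lra.
have := @parameterized_integral_continuous R _ _ (nn f) (ltW cc)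
  (integrable_nn f (- c) c lf nc0).
move=> /(continuous_within_itvP _ cc)[/(_ t)] + _ _.
rewrite in_itv => /(_ tc).
rewrite /parameterized_integral /Rintegral.
by under eq_fun do rewrite prim_nn//.
Qed.

Lemma prim_derive f : locally_finite f ->
  {ae mu, forall x, 0 < x -> derivable (prim f) x 1 /\ derive1 (prim f) x = f x}.
Proof.
move=> lf.
have [|] := @FTC1 R (nn f) (BLeft 0) (fun y => integrable_nn f 0 y lf (lexx 0)).
  split; [|exact: openT|].
    apply/(measurable_restrictT _ _).1; first exact: measurable_nonneg_times.
    by case: lf => mf _ _; exact: measurable_funS mf.
  move=> C _ cC; have [c [_ Cc]] := compact_bounded cC.
  pose d := `|c| + 1.
  have d0 : - d <= 0 by rewrite oppr_le0 addr_ge0.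
  have /integrableP[mF] := integrable_nn f (- d) d lf d0.
  apply: le_lt_trans; apply: ge0_subset_integral => //=.
  - exact: compact_measurable.
  - by apply/measurable_EFinP/measurableT_comp => //; exact/measurable_EFinP.
  - move=> x Cx; rewrite /= in_itv/= -ler_norml.
    by apply: (Cc d) => //; rewrite (le_lt_trans (ler_norm c))// ltrDl.
move=> N [mN N0 NF]; exists N; split => // x xF; apply: NF => /= FT; apply: xF => x0.
have [] := FT; first by rewrite lte_fin.
have E : (fun x => \int[mu]_(t in `[0, x]) nn f t)%R = prim f.
  by apply/funext => y; rewrite /Rintegral prim_nn.
by rewrite E => dF ->; split => //; rewrite /nn patchE mem_set//; exact: ltW.
Qed.

End Primitive.

Section PrimitiveOrder.
Context {R : realType}.
Local Notation mu := (@lebesgue_measure R).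
Implicit Types (f g : R -> R) (t a b c : R) (D : set R).

Lemma first_nonpositive (h : R -> R) a b : continuous h -> a <= b -> 0 < h a -> h b <= 0 ->
  exists2 v : R, a < v <= b & h v <= 0 /\ forall u, a <= u < v -> 0 < h u.
Proof.
move=> ch ab ha hb; pose A := [set x : R | a <= x /\ h x <= 0].
have lA : has_lbound A by exists a => x [].
have iA : has_inf A by split => //; exists b.
pose v := inf A.
have av : a <= v by apply: lb_le_inf => [|x []//]; exists b.
have hv : h v <= 0.
  rewrite leNgt; apply/negP => hv0.
  have := cvgr_gt _ (ch v) _ hv0 => -[e /= e0 he].
  have [x Ax xv] := inf_adherent e0 iA.
  suff : 0 < h x by rewrite ltNge Ax.2.
  apply: he; rewrite /ball_/=.
  have vx := ge_inf lA Ax.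
  by rewrite distrC ger0_norm ?subr_ge0// ltrBlDl.
exists v; last first.
  split=> // u /andP[au uv]; rewrite ltNge; apply/negP => hu.
  by have := ge_inf lA (conj au hu : A u); rewrite leNgt uv.
rewrite (ge_inf lA)//= andbT lt_neqAle av andbT.
by apply/eqP => vE; move: hv; rewrite -vE leNgt ha.
Qed.

Let integral_le_sup_prim_bounded f D c : locally_finite f -> 0 <= c -> measurable D ->
  D `<=` @nonneg_times R -> has_ubound D -> (forall u, D u -> prim f u <= c) ->
  (\int[mu]_(u in D) (f u)%:E <= c%:E)%E.
Proof.
move=> lf c0 mD D0 uD Dc; have [mf f0 _] := lf.
have [->|/set0P nD] := eqVneq D set0; first by rewrite integral_set0 lee_fin.
have sD : has_sup D by [].
apply: (@le_trans _ _ (prim f (sup D))%:E).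
  rewrite primE//; apply: ge0_subset_integral => //.
  - exact: measurable_upto.
  - by apply/measurable_EFinP; exact: measurable_funS mf.
  - by move=> u _; rewrite lee_fin.
  - by move=> u Du; rewrite /upto/= (D0 u Du) (ub_le_sup uD).
rewrite lee_fin leNgt; apply/negP => lt.
have := cvgr_gt _ (prim_continuous f lf (sup D)) _ lt => -[e /= e0 he].
have [x Dx xs] := sup_adherent e0 sD.
suff : c < prim f x by rewrite ltNge Dc.
apply: he; rewrite /ball_/=.
have vx := ub_le_sup uD Dx.
by rewrite ger0_norm ?subr_ge0// ltrBlDl -ltrBlDr.
Qed.

Lemma integral_le_sup_prim f D c : locally_finite f -> 0 <= c -> measurable D ->
  D `<=` @nonneg_times R -> (forall u, D u -> prim f u <= c) ->
  (\int[mu]_(u in D) (f u)%:E <= c%:E)%E.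
Proof.
move=> lf c0 mD D0 Dc; have [mf f0 _] := lf.
pose E (n : nat) := D `&` upto (n%:R : R).
have mE n : measurable (E n) by apply: measurableI => //; exact: measurable_upto.
have -> : D = \bigcup_n E n.
  apply/seteqP; split => [u Du|u [n _ []]//].
  exists (Num.truncn u).+1 => //; split=> //; rewrite /upto/= (D0 u Du)/=.
  exact/ltW/truncnS_gt.
have nE : nondecreasing_seq E.
  move=> m n mn; apply/subsetPset => u [Du /andP[u0 um]]; split => //.
  by rewrite /upto/= u0 (le_trans um)// ler_nat.
have C : (\int[mu]_(u in E n) (f u)%:E @[n --> \oo] -->
    \int[mu]_(u in \bigcup_n E n) (f u)%:E)%E.
  apply: ge0_nondecreasing_set_cvg_integral => //.
  - by move=> n; apply/measurable_EFinP; exact: measurable_funS mf.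
  - by move=> n u _; rewrite lee_fin.
rewrite -(cvg_lim _ C)//; apply: lime_le; first by apply/cvg_ex; eexists; exact: C.
near=> n; apply: integral_le_sup_prim_bounded => //.
- by move=> u [Du _]; exact: D0.
- by exists n%:R => u [_ /andP[]].
- by move=> u [Du _]; exact: Dc.
Unshelve. all: by end_near. Qed.

Lemma prim_ae0 f a b : locally_finite f -> 0 <= a -> a <= b ->
  {ae mu, forall u, a < u < b -> f u = 0} -> prim f b = prim f a.
Proof.
move=> lf a0 ab ae0; have [mf f0 _] := lf.
apply/eqP; rewrite -subr_eq0 -eqe -prim_itv//; apply/eqP.
rewrite (@ge0_ae_eq_integral _ _ _ mu _ _ (cst 0%E))//.
- exact: integral0.
- by apply/measurable_EFinP; exact: measurable_funS mf.
- by move=> u _; rewrite lee_fin.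
- move: ae0; apply: filterS; first exact: (ae_filter_ringOfSetsType mu).
  by move=> u h /=; rewrite in_itv/= => /h ->.
Qed.

Lemma prim_le_integral_down f D c : locally_finite f -> measurable D -> D 0 ->
  (forall u v, 0 <= u -> u <= v -> D v -> D u) ->
  has_ubound D -> (forall u, 0 <= u -> ~ D u -> c <= prim f u) ->
  (c%:E <= \int[mu]_(u in D) (f u)%:E)%E.
Proof.
move=> lf mD D0 dD uD Dc; have [mf f0 _] := lf.
have sD : has_sup D by split => //; exists 0.
have s0 : 0 <= sup D by exact: ub_le_sup.
apply: (@le_trans _ _ (prim f (sup D))%:E); last first.
  rewrite -[prim _ _]subr0 -(@prim_le0 _ f 0)// -prim_itv//.
  apply: ge0_subset_integral => //.
  - by apply/measurable_EFinP; exact: measurable_funS mf.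
  - by move=> u _; rewrite lee_fin.
  - move=> u /=; rewrite in_itv/= => /andP[u0 us].
    have [x Dx xs] : exists2 x, D x & u < x.
      have us' : 0 < sup D - u by rewrite subr_gt0.
      by have [x Dx] := sup_adherent us' sD; rewrite subKr => ux; exists x.
    exact: dD (ltW u0) (ltW xs) Dx.
rewrite lee_fin leNgt; apply/negP => lt.
have := cvgr_lt _ (prim_continuous f lf (sup D)) _ lt => -[e /= e0 he].
have e2 : 0 < e / 2 by rewrite divr_gt0.
have : prim f (sup D + e / 2) < c.
  apply: he; rewrite /ball_/= opprD addNKr normrN gtr0_norm//.
  by rewrite ltr_pdivrMr// mulr_natr mulr2n ltrDl.
rewrite ltNge Dc//; first by rewrite addr_ge0// ltW.
by move=> /(ub_le_sup uD); rewrite gerDl leNgt e2.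
Qed.

(* Where the difference of two primitives attains its minimum it is almost everywhere
   differentiable with zero derivative. *)
Lemma prim_min_ae f g t c : locally_finite f -> locally_finite g ->
  (forall u, 0 < u < t -> c <= prim g u - prim f u) ->
  {ae mu, forall v, 0 < v < t -> prim g v - prim f v = c -> f v = g v}.
Proof.
move=> lf lg cle.
have [A [mA A0 Af]] := prim_derive f lf; have [B [mB B0 Bg]] := prim_derive g lg.
exists (A `|` B); split; [exact: measurableU|by rewrite measureU0|].
move=> v; apply: contra_notP => /not_orP[nA nB] /andP[v0 vt] vc.
have [df Ef] : derivable (prim f) v 1 /\ derive1 (prim f) v = f v.
  by apply: contrapT => h; apply: nA; apply: Af => /(_ v0).
have [dg Eg] : derivable (prim g) v 1 /\ derive1 (prim g) v = g v.
  by apply: contrapT => h; apply: nB; apply: Bg => /(_ v0).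
have dh := derivableB dg df.
have Eh : derive1 (prim g - prim f) v = g v - f v.
  by rewrite derive1E deriveB// -!derive1E Ef Eg.
pose H := (prim g - prim f : R -> R).
have HE u : H u = prim g u - prim f u by [].
pose q (h : R) : R := h^-1 *: ((H \o shift v) (h *: 1) - H v).
have qE : q h @[h --> 0^'] --> g v - f v by rewrite -Eh derive1E; exact: dh.
have Hv h : - v < h < t - v -> 0 <= (H \o shift v) (h *: 1) - H v.
  move=> /andP[h1 h2]; rewrite subr_ge0 /= [h%:A]mulr1 !HE vc; apply: cle; lra.
apply/eqP; rewrite eq_le; apply/andP; split; rewrite -subr_ge0.
  have q1 := cvg_dnbhs_at_right qE.
  rewrite -(cvg_lim _ q1)//; apply: limr_ge; first by apply/cvg_ex; exists (g v - f v).
  near=> h; have h0 : 0 < h by near: h; exact: nbhs_right_gt.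
  rewrite /q /GRing.scale/= mulr_ge0 ?invr_ge0 ?(ltW h0)//; apply: Hv.
  rewrite (lt_trans _ h0) ?oppr_lt0//=.
  by near: h; apply: nbhs_right_lt; rewrite subr_gt0.
rewrite -oppr_le0 opprB.
  have q1 := cvg_dnbhs_at_left qE.
  rewrite -(cvg_lim _ q1)//; apply: limr_le; first by apply/cvg_ex; exists (g v - f v).
  near=> h; have h0 : h < 0 by near: h; exact: nbhs_left_lt.
  rewrite /q /GRing.scale/= mulr_le0_ge0 ?invr_le0 ?(ltW h0)//; apply: Hv.
  rewrite (lt_trans h0) ?subr_gt0// andbT.
  by near: h; apply: nbhs_left_gt; rewrite oppr_lt0.
Unshelve. all: by end_near. Qed.

End PrimitiveOrder.

Section LayerCake.
Context {R : realType}.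
Local Notation mu := (@lebesgue_measure R).

Lemma telescope_indicator (g : nat -> R) (J n : nat) : g 0 = 0 -> (n <= J)%N ->
  g n = \sum_(m < J) (g m.+1 - g m) * (m < n)%N%:R.
Proof.
move=> g0 nJ; rewrite -(subnKC nJ) big_split_ord/= [X in _ + X]big1 ?addr0; last first.
  by move=> i _; rewrite ltnNge leq_addr mulr0.
under eq_bigr do rewrite ltn_ord mulr1.
by rewrite -(big_mkord xpredT (fun m => g m.+1 - g m)) telescope_sumr// g0 subr0.
Qed.

Lemma layer_cake (g : nat -> R) (J : nat) (n : R -> nat) (f : R -> R) (A : set R) :
  g 0 = 0 -> {homo g : i j / (i <= j)%N >-> i <= j} -> (forall u, n u <= J)%N ->
  measurable A -> (forall m, measurable [set u | m < n u]%N) ->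
  measurable_fun setT f -> (forall u, 0 <= f u) ->
  (\int[mu]_(u in A) (g (n u) * f u)%:E =
   \sum_(m < J) (g m.+1 - g m)%:E * \int[mu]_(u in A `&` [set u | m < n u]%N) (f u)%:E)%E.
Proof.
move=> g0 gnd nJ mA mn mf f0.
have mfE B : measurable_fun B (fun u => (f u)%:E).
  by apply/measurable_EFinP; exact: measurable_funS mf.
have dg m : 0 <= g m.+1 - g m by rewrite subr_ge0; exact: gnd.
have mfm m : measurable_fun A (fun u => ((fun u => (f u)%:E) \_ [set u | m < n u]%N) u).
  apply: measurable_funS (measurableT) (@subsetT _ A) _.
  by apply/(measurable_restrictT _ _).1 => //; exact: mfE.
have fm0 m u : (0 <= ((fun u => (f u)%:E) \_ [set u | m < n u]%N) u)%E.
  by rewrite patchE; case: ifP => // _; rewrite lee_fin.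
under eq_integral => u _.
  rewrite (telescope_indicator g J (n u) g0 (nJ u)) mulr_suml -sumEFin.
  under eq_bigr => m _.
    have -> : ((g m.+1 - g m) * (m < n u)%N%:R * f u)%:E =
      ((g m.+1 - g m)%:E * ((fun u => (f u)%:E) \_ [set u | m < n u]%N) u)%E.
      rewrite patchE -mulrA EFinM; congr (_ * _)%E.
      case: ifPn => [|]; rewrite ?(inE, notin_setE)/=; first by move=> ->; rewrite mul1r.
      by move=> /negP/negbTE->; rewrite mul0r.
    over.
  over.
rewrite ge0_integral_sum//=.
- apply: eq_bigr => m _; rewrite ge0_integralZl_EFin//=; first by rewrite integral_mkcondr.
  exact: mfm.
- by move=> m; apply: measurable_funeM; exact: mfm.
- by move=> m u _; rewrite mule_ge0// lee_fin.
Qed.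

End LayerCake.

Lemma sum_le_sum_larger {R : realType} (T : finType) (w : T -> R) (A B : {set T}) :
  (#|A| <= #|B|)%N -> (forall i, 0 <= w i) ->
  (forall i j, i \in A -> j \notin A -> w i <= w j) ->
  \sum_(i in A) w i <= \sum_(i in B) w i.
Proof.
move=> AB w0 wle.
rewrite (big_setID B)/= [leRHS](big_setID A)/= finset.setIC lerD2l.
have cD : (#|A :\: B| <= #|B :\: A|)%N.
  by rewrite !cardsD [X in (_ <= _ - #|pred_of_set X|)%N]finset.setIC leq_sub2r.
have [E|[i0 i0D]] := finset.set_0Vmem (A :\: B).
  by rewrite E big_set0 sumr_ge0.
have [i iD imax] := @arg_maxP _ _ _ i0 (mem (A :\: B)) w i0D.
apply: (@le_trans _ _ (\sum_(j in A :\: B) w i)).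
  by apply: ler_sum => j jD; exact: imax.
apply: (@le_trans _ _ (\sum_(j in B :\: A) w i)).
  by rewrite !sumr_const; apply: ler_wpMn2l.
apply: ler_sum => j; rewrite !inE => /andP[jA _]; apply: wle => //.
by have : i \in A :\: B := iD; rewrite !inE => /andP[].
Qed.

Section MinWork.
Context {R : realType} (I : instance R) (wfI : wf_instance I).

Definition minwork (r : nat) : R :=
  \big[Num.min/wtot I]_(A : {set 'I_(njobs I)} | (r <= #|A|)%N) \sum_(i in A) jsize I i.

Lemma jsize_ge0 i : 0 <= jsize I i.
Proof. by apply: sumr_ge0 => x _; case: wfI => h _; exact/ltW. Qed.

Lemma jsize_le_wmax i : jsize I i <= wmax I.
Proof. exact: le_bigmax. Qed.

Lemma wmax_ge0 : 0 <= wmax I.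
Proof. by rewrite /wmax; apply: bigmax_ge_id. Qed.

Lemma minwork_le r (A : {set 'I_(njobs I)}) : (r <= #|A|)%N ->
  minwork r <= \sum_(i in A) jsize I i.
Proof. exact: bigmin_le_cond. Qed.

Lemma le_minwork r c : (forall A : {set 'I_(njobs I)}, (r <= #|A|)%N ->
  c <= \sum_(i in A) jsize I i) -> (r <= njobs I)%N -> c <= minwork r.
Proof.
move=> h rJ; apply: le_bigmin => //; have := h [set: _]%SET.
by rewrite cardsT card_ord rJ => /(_ isT); rewrite /wtot; under eq_bigl do rewrite inE.
Qed.

Lemma minwork_nd r s : (r <= s)%N -> (s <= njobs I)%N -> minwork r <= minwork s.
Proof.
move=> rs sJ; apply: le_minwork => // A sA.
by apply: minwork_le; exact: leq_trans sA.
Qed.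

Lemma minwork_ge0 r : 0 <= minwork r.
Proof.
have S0 (A : pred 'I_(njobs I)) : 0 <= \sum_(i | A i) jsize I i.
  by apply: sumr_ge0 => i _; exact: jsize_ge0.
by apply: le_bigmin => [|A _]; exact: S0.
Qed.

Lemma minwork_all : minwork (njobs I) = wtot I.
Proof.
apply/eqP; rewrite eq_le bigmin_le_id/=; apply: le_bigmin => // A JA.
have -> : A = [set: _]%SET.
  by apply/eqP; rewrite eqEcard finset.subsetT cardsT card_ord.
by rewrite [leRHS](eq_bigl xpredT)// => i; rewrite inE.
Qed.

End MinWork.

Section ScheduleRates.
Context {R : realType} (K : nat) (I : instance R) (S : schedule R K (task I)).
Hypotheses (wfI : wf_instance I) (feasS : feasible K I S).
Local Notation mu := (@lebesgue_measure R).
Local Notation rate := (rate K I S).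
Local Notation finished := (finished K I S).
Local Notation unfinished := (unfinished K I S).
Local Notation unfinished_jobs := (unfinished_jobs K I S).
Local Notation nunf := (nunf K I S).

Let speed_ge0 k u : 0 <= speed S k u. Proof. by case: feasS. Qed.

Definition jrate (i : 'I_(njobs I)) (u : R) : R := \sum_(x | job I x == i) rate x u.
Definition trate (u : R) : R := \sum_(i < njobs I) jrate i u.

Lemma rate_ge0 x u : 0 <= rate x u.
Proof. by apply: sumr_ge0 => k _; case: ifP. Qed.

Lemma jrate_ge0 i u : 0 <= jrate i u.
Proof. by apply: sumr_ge0 => x _; exact: rate_ge0. Qed.

Lemma measurable_rate x : measurable_fun setT (rate x).
Proof.
apply: measurable_sum => k; case: feasS => _ mS mA _ _.
apply: measurable_fun_ifT => //.
apply: (@measurable_fun_bool _ _ _ _ true).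
rewrite setTI (_ : _ @^-1` _ = assign S k @^-1` [set Some x])//.
by apply/seteqP; split => u /= /eqP.
Qed.

Lemma jrateE i u : jrate i u = \sum_(k < K)
  (if assign S k u is Some x then if job I x == i then speed S k u else 0 else 0).
Proof.
rewrite /jrate /Defs.rate exchange_big/=; apply: eq_bigr => k _.
case E : (assign S k u) => [x|]; last by rewrite big1.
rewrite big_mkcond (bigD1 x)//= eqxx big1 ?addr0// => y yx.
by rewrite (inj_eq (@Some_inj _)) [x == y]eq_sym (negbTE yx); case: ifP.
Qed.

Lemma trateE u : trate u = \sum_(k < K) (if assign S k u is Some _ then speed S k u else 0).
Proof.
rewrite /trate; under eq_bigr do rewrite jrateE.
rewrite exchange_big/=; apply: eq_bigr => k _.
case: (assign S k u) => [x|]; last by rewrite big1.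
rewrite (bigD1 (job I x))//= eqxx big1 ?addr0// => i.
by rewrite eq_sym => /negbTE->.
Qed.

Lemma trate_le_speed u : trate u <= \sum_(k < K) speed S k u.
Proof. by rewrite trateE; apply: ler_sum => k _; case: (assign S k u). Qed.

Lemma rate_le_trate x u : rate x u <= trate u.
Proof.
rewrite /trate (bigD1 (job I x))//= /jrate (bigD1 x)//= -addrA lerDl addr_ge0//.
  by apply: sumr_ge0 => y _; exact: rate_ge0.
by apply: sumr_ge0 => i _; exact: jrate_ge0.
Qed.

Lemma locally_finite_rate : (forall t, (\int[mu]_(u in upto t)
    (\sum_(k < K) speed S k u)%:E < +oo)%E) -> forall x, locally_finite (rate x).
Proof.
move=> fin x; split; [exact: measurable_rate|exact: rate_ge0|move=> t].
apply: le_lt_trans (fin t); apply: ge0_le_integral.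
- exact: measurable_upto.
- by move=> u _; rewrite lee_fin rate_ge0.
- apply/measurable_EFinP; apply: measurable_funS (measurable_rate x) => //.
- apply/measurable_EFinP; apply: measurable_sum => k; case: feasS => _ mS _ _ _.
  exact: measurable_funS (mS k).
- by move=> u _; rewrite lee_fin (le_trans (rate_le_trate x u))// trate_le_speed.
Qed.

Hypothesis lfS : forall x, locally_finite (rate x).

Definition jwork (i : 'I_(njobs I)) (t : R) : R := prim (jrate i) t.

Lemma locally_finite_jrate i : locally_finite (jrate i).
Proof. exact: locally_finite_sum. Qed.

Lemma locally_finite_trate : locally_finite trate.
Proof. by apply: locally_finite_sum => i; exact: locally_finite_jrate. Qed.

Lemma jworkE i t : jwork i t = \sum_(x | job I x == i) prim (rate x) t.
Proof. exact: prim_sum. Qed.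

Lemma prim_trate t : prim trate t = \sum_i jwork i t.
Proof. by apply: prim_sum => i; exact: locally_finite_jrate. Qed.

Lemma workE x t : work K I S x t = (prim (rate x) t)%:E.
Proof. by rewrite primE. Qed.

Lemma finishedE x t : finished x t = (tsize I x <= prim (rate x) t).
Proof. by rewrite /Defs.finished workE lee_fin. Qed.

Lemma finished_le x s t : s <= t -> finished x s -> finished x t.
Proof. by rewrite !finishedE => st /le_trans; apply; exact: prim_nd. Qed.

Lemma unfinished_jobs_le s t : s <= t -> unfinished_jobs t \subset unfinished_jobs s.
Proof.
move=> st; apply/fintype.subsetP => i; rewrite !inE => /existsP[x /andP[xi ux]].
by apply/existsP; exists x; rewrite xi; apply: contra ux; exact: finished_le.
Qed.

Lemma nunf_le s t : s <= t -> (nunf t <= nunf s)%N.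
Proof. by move=> st; apply: subset_leq_card; exact: unfinished_jobs_le. Qed.

Lemma nunf_le_njobs t : (nunf t <= njobs I)%N.
Proof. by rewrite -[leqRHS]card_ord max_card. Qed.

Lemma nunf0 : nunf 0 = njobs I.
Proof.
rewrite -[RHS]card_ord -cardsT /Defs.nunf; congr #|pred_of_set _|.
apply/setP => i; rewrite !inE; case: wfI => w0 /(_ i)[x xi].
by apply/existsP; exists x; rewrite xi eqxx/= /Defs.unfinished finishedE prim_le0// -ltNge.
Qed.

Lemma measurable_nunf_gt m : measurable [set u | (m < nunf u)%N].
Proof.
apply: is_interval_measurable => s t/= ms mt u /andP[_ ut].
by rewrite (leq_trans mt)// nunf_le.
Qed.

Lemma measurable_nunf : measurable_fun setT (fun u => (nunf u)%:R : R).
Proof.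
apply: nonincreasing_measurable => // s t st.
by rewrite ler_nat nunf_le.
Qed.

Lemma job_finished_jwork i t : i \notin unfinished_jobs t -> jsize I i <= jwork i t.
Proof.
rewrite inE negb_exists => /forallP h; rewrite jworkE; apply: ler_sum => x xi.
by have := h x; rewrite xi negbK finishedE.
Qed.

Lemma jwork_ge0 i t : 0 <= jwork i t.
Proof. by apply: prim_ge0; exact: locally_finite_jrate. Qed.

Lemma card_finished_jobs t : #|~: unfinished_jobs t| = (njobs I - nunf t)%N.
Proof. by rewrite cardsCs finset.setCK card_ord. Qed.

Lemma minwork_le_prim t m : (nunf t <= m)%N -> minwork I (njobs I - m) <= prim trate t.
Proof.
move=> tm; rewrite prim_trate.
apply: (le_trans (minwork_le I _ (~: unfinished_jobs t) _)).
  by rewrite card_finished_jobs leq_sub2l.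
rewrite [leRHS](bigID (mem (~: unfinished_jobs t)))/= ler_wpDr//.
  by apply: sumr_ge0 => i _; exact: jwork_ge0.
by apply: ler_sum => i; rewrite inE; exact: job_finished_jwork.
Qed.

End ScheduleRates.

Section LowerBound.
Context {R : realType} (P Pinv : R -> R) (hP : power_assumption P Pinv).
Context (K : nat) (hK : (1 <= K)%N).
Local Notation mu := (@lebesgue_measure R).

(* Half the cost per unit of work when [m] jobs are unfinished and the [K] servers all run
   at the speed [Pinv (m / K)]. *)
Definition work_price (m : nat) : R := (m%:R / K%:R) / Pinv (m%:R / K%:R).

Let K0 : 0 < K%:R :> R. Proof. by rewrite ltr0n. Qed.

Lemma work_price0 : work_price 0 = 0.
Proof. by rewrite /work_price !mul0r. Qed.

Lemma work_price_nd : {homo work_price : i j / (i <= j)%N >-> i <= j}.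
Proof.
move=> i j ij; apply: (marginal_le P Pinv hP); first by rewrite divr_ge0.
by rewrite ler_pM2r ?invr_gt0// ler_nat.
Qed.

Lemma work_price_ge0 m : 0 <= work_price m.
Proof. by rewrite -work_price0; exact: work_price_nd. Qed.

Lemma work_price1_gt0 : 0 < work_price 1.
Proof. by rewrite divr_gt0 ?(Pinv_gt0 P Pinv hP)// divr_gt0. Qed.

Lemma work_priceK : work_price K = (Pinv 1)^-1.
Proof. by rewrite /work_price divff ?gt_eqF// mul1r. Qed.

Definition cost_bound (I : instance R) : R :=
  \sum_(m < njobs I) (work_price m.+1 - work_price m) * minwork I (njobs I - m).

Lemma work_price_wtot (I : instance R) : wf_instance I -> (0 < njobs I)%N ->
  work_price 1 * wtot I <= cost_bound I.
Proof.
rewrite /cost_bound -(minwork_all I); case: (njobs I) (minwork_ge0 I) => // J mw0 wf _.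
rewrite big_ord_recl/= work_price0 subr0 subn0 lerDl sumr_ge0// => i _.
by rewrite mulr_ge0 ?mw0// subr_ge0 work_price_nd.
Qed.

Lemma measurable_power (s : R -> R) : measurable_fun setT s -> (forall u, 0 <= s u) ->
  measurable_fun setT (fun u => P (s u)).
Proof.
move=> ms s0.
have -> : (fun u => P (s u)) = (fun x => P (Num.max x 0)) \o s.
  by apply/funext => u /=; rewrite max_l.
apply: measurableT_comp => //; apply: nondecreasing_measurable => // x y xy.
apply: (power_le P Pinv hP); first by rewrite le_max lexx orbT.
by rewrite le_max2// lexx.
Qed.

Section Competitor.
Context (I : instance R) (S : schedule R K (task I)).
Hypotheses (wfI : wf_instance I) (feasS : feasible K I S).

Let speed_ge0 k u : 0 <= speed S k u. Proof. by case: feasS. Qed.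

Lemma measurable_sum_power : measurable_fun setT (fun u => \sum_(k < K) P (speed S k u)).
Proof.
by apply: measurable_sum => k; apply: measurable_power => //; case: feasS.
Qed.

Lemma sum_power_ge0 u : 0 <= \sum_(k < K) P (speed S k u).
Proof. by apply: sumr_ge0 => k _; exact: (power_ge0 P Pinv hP). Qed.

Lemma work_price_trate n u :
  work_price n * trate K I S u <= n%:R + \sum_(k < K) P (speed S k u).
Proof.
apply: (le_trans (ler_wpM2l (work_price_ge0 n) (trate_le_speed K I S feasS u))).
rewrite mulr_sumr.
have -> : n%:R = \sum_(k < K) n%:R / K%:R :> R.
  by rewrite sumr_const card_ord -[_ *+ K]mulr_natr divfK ?gt_eqF.
rewrite -big_split/=; apply: ler_sum => k _; rewrite mulrC.
by apply: (young_power P Pinv hP) => //; rewrite divr_ge0.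
Qed.

Lemma locally_finite_of_power : (\int[mu]_(u in @nonneg_times R)
    (\sum_(k < K) P (speed S k u))%:E < +oo)%E ->
  forall x, locally_finite (rate K I S x).
Proof.
move=> Pfin; apply: locally_finite_rate => // t.
have [c c0 cP] := speed_le_power P Pinv hP.
have mP := measurable_sum_power.
apply: (@le_lt_trans _ _ (\int[mu]_(u in upto t)
   ((K%:R * c)%:E + (\sum_(k < K) P (speed S k u))%:E))%E).
  apply: ge0_le_integral.
  - exact: measurable_upto.
  - by move=> u _; rewrite lee_fin sumr_ge0.
  - apply/measurable_EFinP; apply: measurable_sum => k; case: feasS => _ mS _ _ _.
    exact: measurable_funS (mS k).
  - apply: emeasurable_funD => //; apply/measurable_EFinP.
    exact: measurable_funS mP.
  - move=> u _; rewrite -EFinD lee_fin mulr_natl -[X in _ *+ X]card_ord -sumr_const.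
    by rewrite -big_split/=; apply: ler_sum => k _; exact: cP.
rewrite ge0_integralD//=; last 4 first.
- exact: measurable_upto.
- by move=> u _; rewrite lee_fin mulr_ge0.
- by move=> u _; rewrite lee_fin sum_power_ge0.
- by apply/measurable_EFinP; exact: measurable_funS mP.
apply: lte_add_pinfty.
  rewrite integral_cst/=; last exact: measurable_upto.
  rewrite uptoE lebesgue_measure_itv/=; case: ifP => _; last by rewrite mule0.
  by rewrite -EFinB -EFinM ltry.
apply: le_lt_trans Pfin; apply: ge0_subset_integral.
- exact: measurable_upto.
- exact: measurable_nonneg_times.
- by apply/measurable_EFinP; exact: measurable_funS mP.
- by move=> u _; rewrite lee_fin sum_power_ge0.
- by move=> u /andP[].
Qed.

Lemma cost_bound_le_cost : ((cost_bound I)%:E <= cost P K I S)%E.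
Proof.
have [->|] := eqVneq (cost P K I S) +oo%E; first by rewrite leey.
rewrite -ltey /cost => cfin.
have mN := measurable_nonneg_times (R := R).
set In := integral _ _ _ in cfin *; set IP := integral _ _ _ in cfin *.
have In0 : (0 <= In)%E by apply: integral_ge0 => u _; rewrite lee_fin.
have IP0 : (0 <= IP)%E by apply: integral_ge0 => u _; rewrite lee_fin sum_power_ge0.
have Infin : (In < +oo)%E by apply: le_lt_trans cfin; rewrite leeDl.
have lfS : forall x, locally_finite (rate K I S x).
  by apply: locally_finite_of_power; apply: le_lt_trans cfin; rewrite leeDr.
have mn := measurable_nunf K I S lfS.
have mP := measurable_sum_power.
have [mt t0 _] := locally_finite_trate K I S lfS.
apply: (@le_trans _ _ (\int[mu]_(u in @nonneg_times R)
    (work_price (nunf K I S u) * trate K I S u)%:E)%E); last first.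
  rewrite /In /IP -ge0_integralD//; last 3 first.
  - by apply/measurable_EFinP; exact: measurable_funS mn.
  - by move=> u _; rewrite lee_fin sum_power_ge0.
  - by apply/measurable_EFinP; exact: measurable_funS mP.
  apply: ge0_le_integral => //.
  - by move=> u _; rewrite lee_fin mulr_ge0// work_price_ge0.
  - apply/measurable_EFinP; apply: measurable_funS (@subsetT _ _) _ => //.
    apply: measurable_funM => //; apply: nonincreasing_measurable => // s t st.
    by apply: work_price_nd; exact: nunf_le.
  - apply: emeasurable_funD; apply/measurable_EFinP.
      exact: measurable_funS mn.
    exact: measurable_funS mP.
  - by move=> u _; rewrite -EFinD lee_fin work_price_trate.
rewrite (layer_cake work_price (njobs I)) //; last 4 first.
- exact: work_price0.
- exact: work_price_nd.
- exact: nunf_le_njobs.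
- by move=> m; exact: measurable_nunf_gt.
rewrite /cost_bound -sumEFin; apply: lee_sum => m _.
rewrite EFinM; apply: lee_wpmul2l; first by rewrite lee_fin subr_ge0 work_price_nd.
apply: prim_le_integral_down.
- exact: locally_finite_trate.
- by apply: measurableI => //; exact: measurable_nunf_gt.
- by split; [rewrite /nonneg_times/=|rewrite /= nunf0].
- move=> u v u0 uv [_ /= mv]; split => //=.
  by rewrite (leq_trans mv)// nunf_le.
- exists (fine In) => u [/= u0 mu_]; rewrite -lee_fin fineK ?ge0_fin_numE//.
  have -> : (u%:E = \int[mu]_(v in upto u) 1)%E.
    rewrite uptoE integral_cst//= mul1e lebesgue_measure_itv/= lte_fin.
    case: ltP => [_|u1]; first by rewrite oppr0 adde0.
    by congr EFin; apply/eqP; rewrite eq_le u1.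
  apply: (@le_trans _ _ (\int[mu]_(v in upto u) ((nunf K I S v)%:R)%:E)%E).
    apply: ge0_le_integral => //.
    + exact: measurable_upto.
    + by apply/measurable_EFinP; exact: measurable_funS mn.
    + move=> v /andP[_ vu]; rewrite lee_fin ler1n (leq_ltn_trans (leq0n m))//.
      by rewrite (leq_trans mu_)// nunf_le.
  apply: ge0_subset_integral => //.
  + exact: measurable_upto.
  + by apply/measurable_EFinP; exact: measurable_funS mn.
  + by move=> v /andP[].
- move=> u u0 nu; apply: minwork_le_prim => //.
  by rewrite leqNgt; apply/negP => mu_; apply: nu.
Qed.

End Competitor.
End LowerBound.

Section JobSRPT.
Context {R : realType} (P Pinv : R -> R) (hP : power_assumption P Pinv).
Context (K : nat) (hK : (1 <= K)%N).
Context (I : instance R) (S : schedule R K (task I)).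
Hypotheses (wfI : wf_instance I) (feasS : feasible K I S) (srptS : job_srpt K I Pinv S).
Local Notation mu := (@lebesgue_measure R).
Local Notation rate := (rate K I S).
Local Notation jrate := (jrate K I S).
Local Notation jwork := (jwork K I S).
Local Notation trate := (trate K I S).
Local Notation finished := (finished K I S).
Local Notation unfinished_jobs := (unfinished_jobs K I S).
Local Notation nunf := (nunf K I S).

Let K0 : 0 < K%:R :> R. Proof. by rewrite ltr0n. Qed.
Let speed_ge0 k u : 0 <= speed S k u. Proof. by case: feasS. Qed.

Lemma srpt_assign_free k t x : 0 <= t -> assign S k t = Some x -> free K I S x t.
Proof.
move=> t0 kx; have := srptS t t0; rewrite /srpt_at; case: ifP => _.
  by move=> [Sel [_ _ _ + _]] => /(_ k)[y []]; rewrite kx => -[<-] _ [].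
move=> [B [_ B1 _ [B2 _ _]]]; have [kB|kB] := boolP (k \in B).
  by have [y []] := B1 k kB; rewrite kx => -[<-] [].
by have [] := B2 k x kB kx.
Qed.

Lemma srpt_speed_le k t : 0 <= t ->
  speed S k t <= Pinv ((njobs I)%:R / K%:R) + Pinv 1.
Proof.
move=> t0; have p1 := Pinv_ge0 P Pinv hP 1 ler01.
have pJ : 0 <= Pinv ((njobs I)%:R / K%:R) by apply: (Pinv_ge0 P Pinv hP); rewrite divr_ge0.
have := srptS t t0; rewrite /srpt_at; case: ifP => _.
  move=> [Sel [_ _ _ + _]] => /(_ k)[y [_ _ _ ->]]; rewrite ler_wpDr//.
  apply: (Pinv_le P Pinv hP); first by rewrite divr_ge0.
  by rewrite ler_pM2r ?invr_gt0// ler_nat nunf_le_njobs.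
move=> [B [_ _ _ [_ _ ->]]]; case: (assign S k t) => [_|]; first by rewrite lerDr.
exact: addr_ge0.
Qed.

Lemma locally_finite_srpt x : locally_finite (rate x).
Proof.
apply: locally_finite_rate => // t.
set c := Pinv ((njobs I)%:R / K%:R) + Pinv 1.
apply: (@le_lt_trans _ _ (\int[mu]_(u in upto t) (\sum_(k < K) c)%:E)%E).
  apply: ge0_le_integral => //.
  - exact: measurable_upto.
  - by move=> u _; rewrite lee_fin sumr_ge0.
  - apply/measurable_EFinP; apply: measurable_sum => k; case: feasS => _ mS _ _ _.
    exact: measurable_funS (mS k).
  - move=> u /andP[u0 _]; rewrite lee_fin; apply: ler_sum => k _.
    exact: srpt_speed_le.
rewrite integral_cst/=; last exact: measurable_upto.
rewrite uptoE lebesgue_measure_itv/=; case: ifP => _; last by rewrite mule0.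
by rewrite -EFinB -EFinM ltry.
Qed.

Let lfS := locally_finite_srpt.

Lemma srpt_rate_finished x t : 0 <= t -> finished x t -> rate x t = 0.
Proof.
move=> t0 fx; apply: big1 => k _; case: eqP => // /(srpt_assign_free _ _ _ t0).
by rewrite /free /Defs.unfinished fx.
Qed.

Lemma srpt_prim_le x t : prim (rate x) t <= tsize I x.
Proof.
rewrite leNgt; apply/negP => lt.
have x0 : 0 < tsize I x by case: wfI.
have t0 : 0 <= t.
  by rewrite leNgt; apply/negP => t0; move: lt; rewrite prim_le0 1?ltW// ltNge (ltW x0).
have ct : {within `[0, t], continuous (prim (rate x))}.
  exact/continuous_subspaceT/prim_continuous.
have [|c] := IVT t0 ct (v := tsize I x).
  by rewrite prim_le0// ge_min le_max (ltW x0) (ltW lt) orbT.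
rewrite in_itv/= => /andP[c0 ct0] cE.
suff E : prim (rate x) t = prim (rate x) c by rewrite E cE ltxx in lt.
apply: prim_ae0 => //; apply: aeW => u /andP[cu _].
apply: srpt_rate_finished; first exact: le_trans (ltW cu).
by rewrite finishedE// -cE; apply: prim_nd => //; exact: ltW.
Qed.

Lemma srpt_jwork_le i t : jwork i t <= jsize I i.
Proof. by rewrite jworkE//; apply: ler_sum => x _; exact: srpt_prim_le. Qed.

Lemma srpt_unfinishedE i t : (i \in unfinished_jobs t) = (jwork i t < jsize I i).
Proof.
apply/idP/idP; last first.
  by apply: contraTT => h; rewrite -leNgt; apply: job_finished_jwork.
rewrite inE => /existsP[x /andP[xi ux]]; rewrite jworkE// /jsize.
rewrite (bigD1 x)//= [ltRHS](bigD1 x)//=; apply: ltr_leD.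
  by rewrite ltNge -finishedE.
by apply: ler_sum => y _; exact: srpt_prim_le.
Qed.

Definition jleft (i : 'I_(njobs I)) (t : R) : R := jsize I i - jwork i t.

Lemma jremE i t : jrem K I S i t = (jleft i t)%:E.
Proof.
rewrite /jleft jworkE// /jsize -sumrB -sumEFin /jrem big_mkcondr/=.
apply: eq_bigr => x _; rewrite /rem workE//; case: ifPn => //.
rewrite negbK finishedE// => le.
have -> : prim (rate x) t = tsize I x by apply/eqP; rewrite eq_le le srpt_prim_le.
by rewrite subrr.
Qed.

Lemma jleft_ge0 i t : 0 <= jleft i t.
Proof. by rewrite subr_ge0 srpt_jwork_le. Qed.

Lemma jleft_finished i t : i \notin unfinished_jobs t -> jleft i t = 0.
Proof.
rewrite srpt_unfinishedE -leNgt => h; apply/eqP.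
by rewrite subr_eq0 eq_le h srpt_jwork_le.
Qed.

Lemma jleft0 i : jleft i 0 = jsize I i.
Proof. by rewrite /jleft [jwork i 0]prim_le0// subr0. Qed.

Lemma srpt_select t : 0 <= t -> (K <= nunf t)%N -> exists Sel : {set 'I_(njobs I)},
  [/\ Sel \subset unfinished_jobs t, #|Sel| = K,
      (forall i j, i \in Sel -> j \in unfinished_jobs t -> j \notin Sel ->
         jleft i t <= jleft j t) &
      (forall i, jrate i t = if i \in Sel then Pinv ((nunf t)%:R / K%:R) else 0)].
Proof.
move=> t0 Kn; have := srptS t t0; rewrite /srpt_at Kn => -[Sel [SU cS ordS asg inj]].
exists Sel; split => //.
  by move=> i j iS jU jS; rewrite -lee_fin -!jremE; apply: ordS => //; rewrite inE jS.
have [x xP] := fin_all_exists asg.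
have phi_inj : injective (fun k => job I (x k)).
  by move=> k k' e; have [ak _ _ _] := xP k; have [ak' _ _ _] := xP k'; exact: inj ak ak' e.
have im : (fun k => job I (x k)) @: [set: 'I_K]%SET = Sel.
  apply/eqP; rewrite eqEcard cS card_imset// cardsT card_ord leqnn andbT.
  by apply/fintype.subsetP => _ /imsetP[k _ ->]; have [] := xP k.
move=> i; rewrite jrateE//.
under eq_bigr => k _ do have [-> _ _ ->] := xP k.
case: ifPn => [|iS].
  rewrite -im => /imsetP[k _ ->]; rewrite (bigD1 k)//= eqxx big1 ?addr0// => k' kk.
  by case: eqP => // /phi_inj e; rewrite e eqxx in kk.
apply: big1 => k _; case: eqP => // e.
by move: iS; rewrite -e; have [_ -> _ _] := xP k.
Qed.

Lemma srpt_jrate_le i j t : 0 <= t -> (K <= nunf t)%N -> i \in unfinished_jobs t ->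
  jleft i t < jleft j t -> jrate j t <= jrate i t.
Proof.
move=> t0 Kn iU ij; have [Sel [_ _ ordS jrE]] := srpt_select t t0 Kn.
rewrite (jrE j); case: ifPn => [jS|_]; last exact: jrate_ge0.
rewrite jrE; case: ifPn => // iS.
by have := ordS j i jS iU iS; rewrite leNgt ij.
Qed.

Lemma jleft_continuous i : continuous (jleft i).
Proof.
move=> t; apply: cvgB; first exact: cvg_cst.
by apply: prim_continuous; exact: locally_finite_jrate.
Qed.

Lemma srpt_order_kept i j u t : 0 <= u -> u <= t -> (K <= nunf t)%N ->
  i \in unfinished_jobs t -> jleft i u < jleft j u -> jleft i t < jleft j t.
Proof.
move=> u0 ut Kn iU ij; rewrite ltNge; apply/negP => ji.
pose h (v : R) := jleft j v - jleft i v.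
have ch : continuous h by move=> v; apply: cvgB; exact: jleft_continuous.
have [||v /andP[uv vt] [hv hpos]] := first_nonpositive h u t ch ut.
- by rewrite subr_gt0.
- by rewrite subr_le0.
have : jwork j v - jwork j u <= jwork i v - jwork i u.
  apply: prim_diff_le => //; [exact: locally_finite_jrate..|exact: ltW|].
  move=> w /andP[uw wv].
  have wt : w <= t by rewrite (le_trans (ltW wv)).
  apply: srpt_jrate_le.
  - exact: le_trans (ltW uw).
  - by rewrite (leq_trans Kn)// nunf_le.
  - by apply: fintype.subsetP iU; exact: unfinished_jobs_le.
  - by rewrite -subr_gt0 hpos// (ltW uw).
by move: hv ij; rewrite /h /jleft; lra.
Qed.

Lemma srpt_finished_smaller i j t : 0 <= t -> (K <= nunf t)%N ->
  i \in unfinished_jobs t -> j \notin unfinished_jobs t -> jsize I j <= jsize I i.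
Proof.
move=> t0 Kn iU jU; rewrite leNgt; apply/negP; rewrite -!jleft0 => ij.
have := srpt_order_kept i j 0 t (lexx _) t0 Kn iU ij.
by rewrite (jleft_finished j)// ltNge jleft_ge0.
Qed.

Definition touched (t : R) : {set 'I_(njobs I)} :=
  [set i in unfinished_jobs t | 0 < jwork i t]%SET.

Lemma in_touched t j :
  (j \in touched t) = (j \in unfinished_jobs t) && (0 < jwork j t).
Proof. by rewrite [LHS]inE. Qed.

(* If more than [K] unfinished jobs were touched, the one with the most remaining work
   would almost never be served: whenever it is, all the others are served as well, by the
   selection rule if they are strictly smaller and, almost everywhere, by equality of the
   derivatives if they are tied with it. *)
Lemma card_touched t : 0 <= t -> (K <= nunf t)%N -> (#|touched t| <= K)%N.
Proof.
move=> t0 Kn; rewrite leqNgt; apply/negP => KT.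
have [i0 i0T] : exists i, i \in touched t by apply/card_gt0P; exact: leq_ltn_trans KT.
have [i iT imax] := @arg_maxP _ _ _ i0 (mem (touched t)) (jleft ^~ t) i0T.
have {}imax j : j \in touched t -> jleft j t <= jleft i t by exact: imax.
have /andP[iU iw] : (i \in unfinished_jobs t) && (0 < jwork i t) by rewrite -in_touched.
have jle j u : j \in touched t -> 0 <= u <= t -> jleft j u <= jleft i u.
  move=> jT /andP[u0 ut]; rewrite leNgt; apply/negP => ij.
  by have := srpt_order_kept i j u t u0 ut Kn iU ij; rewrite ltNge imax.
have lfi := locally_finite_jrate K I S lfS i.
suff : jwork i t = jwork i 0 by rewrite [jwork i 0]prim_le0// => e; rewrite e ltxx in iw.
apply: prim_ae0 => //.
pose Q j (u : R) := j \in touched t -> 0 < u < t ->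
  jleft j u = jleft i u -> jrate i u = jrate j u.
have tie : {ae mu, forall u j, Q j u}.
  apply: (@filter_forall _ _ Q _ (ae_filter_ringOfSetsType mu)) => j.
  have [jT|jT] := boolP (j \in touched t); last first.
    by apply: aeW => u; rewrite /Q (negbTE jT).
  have lfj := locally_finite_jrate K I S lfS j.
  have := prim_min_ae (jrate i) (jrate j) t (jsize I j - jsize I i) lfi lfj.
  have cle u : 0 < u < t -> jsize I j - jsize I i <= jwork j u - jwork i u.
    move=> /andP[u0 ut]; have := jle j u jT; rewrite (ltW u0) (ltW ut) => /(_ isT).
    by rewrite /jleft; lra.
  move=> /(_ cle); apply: filterS; first exact: (ae_filter_ringOfSetsType mu).
  move=> u h _ /h + E; apply; move: E; rewrite /jleft -/(jwork j u) -/(jwork i u); lra.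
move: tie; apply: filterS; first exact: (ae_filter_ringOfSetsType mu).
move=> u tie u0t; have /andP[u0 ut] := u0t.
have Knu : (K <= nunf u)%N by rewrite (leq_trans Kn)// nunf_le// ltW.
have [Sel [SU cS ordS jrE]] := srpt_select u (ltW u0) Knu.
rewrite jrE; case: ifPn => // iS; exfalso; move: KT; rewrite ltnNge => /negP; apply.
rewrite -[X in (_ <= X)%N]cS; apply: subset_leq_card; apply/fintype.subsetP => j jT.
apply/negPn/negP => jS.
have jUu : j \in unfinished_jobs u.
  by apply: fintype.subsetP (unfinished_jobs_le K I S lfS _ _ (ltW ut)) _ _;
     move: jT; rewrite in_touched => /andP[].
have /(tie j jT u0t) : jleft j u = jleft i u.
  by apply/eqP; rewrite eq_le jle ?(ltW u0) ?(ltW ut)//= ordS.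
rewrite !jrE iS (negbTE jS); apply/eqP; rewrite gt_eqF//.
by apply: (Pinv_gt0 P Pinv hP); rewrite divr_gt0// ltr0n (leq_trans hK).
Qed.

Lemma srpt_prim_trate_le t : 0 <= t -> (K <= nunf t)%N ->
  prim trate t <= minwork I (njobs I - nunf t) + K%:R * wmax I.
Proof.
move=> t0 Kn; rewrite prim_trate// (bigID (mem (~: unfinished_jobs t)))/=.
apply: lerD.
  apply: (@le_trans _ _ (\sum_(i in ~: unfinished_jobs t) jsize I i)).
    by apply: ler_sum => i _; exact: srpt_jwork_le.
  apply: le_minwork; last exact: leq_subr.
  move=> A JA; apply: sum_le_sum_larger.
  - by rewrite card_finished_jobs.
  - by move=> i; exact: jsize_ge0.
  - by move=> i j; rewrite !finset.in_setC negbK => iU jU; exact: (srpt_finished_smaller j i t).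
rewrite (bigID (mem (touched t)))/= [X in _ + X]big1 ?addr0; last first.
  move=> i /andP[]; rewrite in_touched finset.in_setC negbK => -> /=; rewrite -leNgt => w0.
  by apply/eqP; rewrite eq_le w0 jwork_ge0.
apply: (@le_trans _ _ (\sum_(i in touched t) wmax I)).
  rewrite (eq_bigl (mem (touched t))); last first.
    by move=> i /=; rewrite in_touched finset.in_setC negbK andbA andbb.
  by apply: ler_sum => i _; apply: le_trans (srpt_jwork_le _ _) (jsize_le_wmax _ _).
rewrite sumr_const -[leLHS]mulr_natl ler_wpM2r ?wmax_ge0// ler_nat.
exact: card_touched.
Qed.

Local Notation price := (work_price Pinv K).

Lemma srpt_cost_rate_many t : 0 <= t -> (K <= nunf t)%N ->
  (nunf t)%:R + \sum_(k < K) P (speed S k t) = 2 * (price (nunf t) * trate t).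
Proof.
move=> t0 Kn; have := srptS t t0; rewrite /srpt_at Kn => -[Sel [_ _ _ asg _]].
have n0 : 0 < (nunf t)%:R / K%:R :> R by rewrite divr_gt0// ltr0n (leq_trans hK).
have p0 := Pinv_gt0 P Pinv hP _ n0.
have -> : \sum_(k < K) P (speed S k t) = (nunf t)%:R.
  under eq_bigr => k _ do have [x [_ _ _ ->]] := asg k.
  rewrite sumr_const card_ord (PinvK P Pinv hP) ?(ltW n0)// -[LHS]mulr_natr.
  by rewrite divfK ?gt_eqF.
have -> : trate t = K%:R * Pinv ((nunf t)%:R / K%:R).
  rewrite trateE//; under eq_bigr => k _ do have [x [-> _ _ ->]] := asg k.
  by rewrite sumr_const card_ord -[LHS]mulr_natl.
by rewrite /work_price; field; rewrite !gt_eqF.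
Qed.

Lemma srpt_cost_rate_few t : 0 <= t -> (nunf t < K)%N ->
  (nunf t)%:R + \sum_(k < K) P (speed S k t) <= 2 * (price K * trate t).
Proof.
move=> t0 nK; have := srptS t t0; rewrite /srpt_at leqNgt nK.
move=> [B [cB asg _ [_ _ spd]]].
have p0 := Pinv_gt0 P Pinv hP _ ltr01.
pose A := [set k | assign S k t]%SET.
have -> : \sum_(k < K) P (speed S k t) = #|A|%:R.
  rewrite -sum1_card natr_sum [RHS]big_mkcond/=; apply: eq_bigr => k _.
  rewrite spd inE; case: (assign S k t) => [a|]/=; first exact: (PinvK P Pinv hP _ ler01).
  exact: (power0 P Pinv hP).
have -> : trate t = #|A|%:R * Pinv 1.
  rewrite trateE// -sum1_card natr_sum mulr_suml [RHS]big_mkcond/=; apply: eq_bigr => k _.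
  by rewrite inE spd; case: (assign S k t) => [a|]/=; rewrite ?mul1r.
have : (nunf t <= #|A|)%N.
  rewrite -cB; apply: subset_leq_card; apply/fintype.subsetP => k /asg[x [kx _]].
  by rewrite inE kx.
rewrite (work_priceK Pinv K hK) [_^-1 * _]mulrC mulfK ?gt_eqF// -(ler_nat R); lra.
Qed.

Lemma srpt_jrate_finished i t : 0 <= t -> i \notin unfinished_jobs t -> jrate i t = 0.
Proof.
rewrite inE negb_exists => t0 /forallP h; apply: big1 => x xi.
by apply: srpt_rate_finished => //; have := h x; rewrite xi negbK.
Qed.

Lemma srpt_work_few : (\int[mu]_(u in @nonneg_times R `\` [set u | K.-1 < nunf u]%N)
  (trate u)%:E <= (K%:R * wmax I)%:E)%E.
Proof.
set E := _ `\` _.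
have mE : measurable E.
  by apply: measurableD; [exact: measurable_nonneg_times|exact: measurable_nunf_gt].
have lfj i := locally_finite_jrate K I S lfS i.
under eq_integral do rewrite -sumEFin.
rewrite ge0_integral_sum//=; last 2 first.
- move=> i; apply/measurable_EFinP; case: (lfj i) => mj _ _.
  exact: measurable_funS mj.
- by move=> i u _; rewrite lee_fin jrate_ge0.
pose V := [set i | `[< exists2 u, E u & i \in unfinished_jobs u >]]%SET.
apply: (@le_trans _ _ (\sum_(i < njobs I) (if i \in V then wmax I else 0)%:E)%E).
  apply: lee_sum => i _; case: ifPn => iV.
    apply: (@le_trans _ _ (jsize I i)%:E); last by rewrite lee_fin jsize_le_wmax.
    apply: integral_le_sup_prim => //.
    + exact: jsize_ge0.
    + by move=> u [].
    + by move=> u _; exact: srpt_jwork_le.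
  rewrite integral0_eq// => u Eu; rewrite srpt_jrate_finished//; first by case: Eu.
  by apply: contra iV => iU; rewrite inE; apply/asboolP; exists u.
rewrite sumEFin lee_fin -big_mkcond/= sumr_const -[leLHS]mulr_natl.
rewrite ler_wpM2r ?wmax_ge0// ler_nat.
have [->|[i0 i0V]] := finset.set_0Vmem V; first by rewrite cards0.
have /fin_all_exists[tm tmP] : forall i, exists u, i \in V -> E u /\ i \in unfinished_jobs u.
  move=> i; have [|iV] := boolP (i \in V); last by exists 0.
  by rewrite inE => /asboolP[u Eu iu]; exists u.
have [i iV imin] := @arg_minP _ _ _ i0 (mem V) tm i0V.
have [[_ /= ni] _] := tmP i iV.
apply: (@leq_trans (nunf (tm i))); last first.
  by move/negP: ni; rewrite -leqNgt => /leq_trans; apply; exact: leq_pred.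
apply: subset_leq_card; apply/fintype.subsetP => j jV.
have [_] := tmP j jV; apply: fintype.subsetP; apply: unfinished_jobs_le => //.
exact: imin.
Qed.

Lemma srpt_cost_le : (K <= njobs I)%N ->
  (cost P K I S <= (2 * cost_bound Pinv K I +
     4 * (K%:R * wmax I * price (njobs I)))%:E)%E.
Proof.
move=> KJ; set N := @nonneg_times R; set B := [set u | K.-1 < nunf u]%N.
have mN : measurable N := measurable_nonneg_times.
have mB : measurable B by exact: measurable_nunf_gt.
have mn := measurable_nunf K I S lfS.
have mP := measurable_sum_power P Pinv hP K I S feasS.
have [mt t0 _] := locally_finite_trate K I S lfS.
have P0 := sum_power_ge0 P Pinv hP K I S feasS.
have wK0 : 0 <= K%:R * wmax I by rewrite mulr_ge0 ?wmax_ge0.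
have pr0 := work_price_ge0 P Pinv hP K hK.
have prnd := work_price_nd P Pinv hP K hK.
have mc : measurable_fun setT (fun u => (nunf u)%:R + \sum_(k < K) P (speed S k u) : R).
  exact: measurable_funD.
have mpr : measurable_fun setT (fun u => price (nunf u) * trate u).
  apply: measurable_funM => //; apply: nonincreasing_measurable => // s t st.
  by apply: prnd; exact: nunf_le.
have -> : cost P K I S =
    (\int[mu]_(u in N) ((nunf u)%:R + \sum_(k < K) P (speed S k u))%:E)%E.
  rewrite /cost -ge0_integralD//.
  - by apply/measurable_EFinP; exact: measurable_funS mn.
  - by move=> u _; rewrite lee_fin.
  - by apply/measurable_EFinP; exact: measurable_funS mP.
rewrite -(setUIDK N B) ge0_integral_setU//; last 5 first.
- exact: measurableI.
- exact: measurableD.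
- by apply/measurable_EFinP; exact: measurable_funS mc.
- by move=> u _; rewrite lee_fin addr_ge0.
- by apply/disj_setPLR => u [_ Bu] [].
have many : (\int[mu]_(u in N `&` B) ((nunf u)%:R + \sum_(k < K) P (speed S k u))%:E <=
    (2 * (cost_bound Pinv K I + K%:R * wmax I * price (njobs I)))%:E)%E.
  have -> : (\int[mu]_(u in N `&` B) ((nunf u)%:R + \sum_(k < K) P (speed S k u))%:E =
      2%:E * \int[mu]_(u in N `&` B) (price (nunf u) * trate u)%:E)%E.
    rewrite -ge0_integralZl_EFin//.
    - apply: eq_integral => u; rewrite inE => -[u0 Ku]; rewrite srpt_cost_rate_many//.
      by rewrite (leq_trans (leqSpred K)).
    - exact: measurableI.
    - by move=> u _; rewrite lee_fin mulr_ge0.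
    - by apply/measurable_EFinP; exact: measurable_funS mpr.
  rewrite EFinM lee_pmul2l//.
  rewrite (layer_cake price (njobs I))//; last 4 first.
  - exact: work_price0.
  - exact: nunf_le_njobs.
  - exact: measurableI.
  - by move=> m; exact: measurable_nunf_gt.
  rewrite [X in _ + _ * X](telescope_indicator price (njobs I) (njobs I))//; last first.
    exact: work_price0.
  rewrite mulr_sumr -big_split/= -sumEFin; apply: lee_sum => m _.
  rewrite ltn_ord mulr1 [K%:R * _ * _]mulrC -mulrDr EFinM.
  apply: lee_wpmul2l; first by rewrite lee_fin subr_ge0 prnd.
  apply: integral_le_sup_prim.
  - exact: locally_finite_trate.
  - by rewrite addr_ge0 ?minwork_ge0.
  - by apply: measurableI; [exact: measurableI|exact: measurable_nunf_gt].
  - by move=> u [[]].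
  - move=> u [[u0 Ku] /= mu_]; apply: le_trans (srpt_prim_trate_le u u0 _) _.
      by rewrite (leq_trans (leqSpred K)).
    rewrite lerD2r; apply: minwork_nd; last exact: leq_subr.
    by rewrite leq_sub2l// ltnW.
have few : (\int[mu]_(u in N `\` B) ((nunf u)%:R + \sum_(k < K) P (speed S k u))%:E <=
    (2 * (K%:R * wmax I * price (njobs I)))%:E)%E.
  have pK0 : 0 <= 2 * price K by rewrite mulr_ge0.
  apply: (@le_trans _ _ ((2 * price K)%:E * \int[mu]_(u in N `\` B) (trate u)%:E)%E).
    rewrite -ge0_integralZl_EFin//; last 3 first.
    - exact: measurableD.
    - by move=> u _; rewrite lee_fin.
    - by apply/measurable_EFinP; exact: measurable_funS mt.
    apply: ge0_le_integral.
    - exact: measurableD.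
    - by move=> u _; rewrite lee_fin addr_ge0.
    - by apply/measurable_EFinP; exact: measurable_funS mc.
    - by apply: measurable_funeM; apply/measurable_EFinP; exact: measurable_funS mt.
    - move=> u [u0 /negP]; rewrite /= -leqNgt => nK.
      rewrite -EFinM lee_fin -mulrA srpt_cost_rate_few//.
      by rewrite (leq_ltn_trans nK)// prednK.
  apply: (@le_trans _ _ ((2 * price K)%:E * (K%:R * wmax I)%:E)%E).
    by apply: lee_wpmul2l; [rewrite lee_fin|exact: srpt_work_few].
  by rewrite -EFinM lee_fin -[leLHS]mulrA ler_pM2l// [leLHS]mulrC ler_wpM2l// prnd.
apply: (le_trans (leeD many few)); rewrite -EFinD lee_fin; lra.
Qed.

End JobSRPT.

Theorem theorem1 (R : realType) (P Pinv : R -> R) (hP : power_assumption P Pinv)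
    (K : nat) (hK : (1 <= K)%N) :
  forall eps : R, 0 < eps ->
  exists delta : R, 0 < delta /\ exists N : nat,
  forall I : instance R, wf_instance I -> (N <= njobs I)%N ->
    K%:R * wmax I * Delta P Pinv ((njobs I)%:R / K%:R) <= delta * wtot I ->
  forall S : schedule R K (task I), feasible K I S -> job_srpt K I Pinv S ->
    lee (cost P K I S)
      (mule (P (2 - (K%:R)^-1) * (2 + 2 / Pinv 1 * Num.max 1 (P (sbar P))) + eps)%:E
            (OPT P K I)).
Proof.
move=> eps eps0.
have K0 : 0 < K%:R :> R by rewrite ltr0n.
have p1 := work_price1_gt0 P Pinv hP K hK.
exists (eps * work_price Pinv K 1 / 4); split; first by rewrite divr_gt0// mulr_gt0.
exists K => I wfI KJ many S feasS srptS.
have J0 : (0 < njobs I)%N := leq_trans hK KJ.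
set C := P _ * _.
have C2 : 2 <= C.
  have PK1 : 1 <= P (2 - K%:R^-1).
    apply: (power_ge1 P Pinv hP); have : K%:R^-1 <= 1 :> R by rewrite invf_le1// ler1n.
    lra.
  apply: (@le_trans _ _ (2 + 2 / Pinv 1 * Num.max 1 (P (sbar P)))).
    rewrite lerDl mulr_ge0//.
      by rewrite divr_ge0// (Pinv_ge0 P Pinv hP).
    by rewrite le_max ler01.
  rewrite ler_peMl// addr_ge0// mulr_ge0//.
    by rewrite divr_ge0// (Pinv_ge0 P Pinv hP).
  by rewrite le_max ler01.
have LB := work_price_wtot P Pinv hP K hK I wfI J0.
have cb0 : 0 <= cost_bound Pinv K I.
  apply: le_trans LB; rewrite mulr_ge0 ?(ltW p1)// sumr_ge0// => i _.
  exact: jsize_ge0.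
have OPTge : ((cost_bound Pinv K I)%:E <= OPT P K I)%E.
  by apply: le_ereal_inf_tmp => _ [S' feasS' <-]; exact: cost_bound_le_cost.
apply: (le_trans (srpt_cost_le P Pinv hP K hK I S wfI feasS srptS KJ)).
apply: (@le_trans _ _ ((C + eps)%:E * (cost_bound Pinv K I)%:E)%E); last first.
  by apply: lee_wpmul2l => //; rewrite lee_fin; lra.
have wJ : K%:R * wmax I * work_price Pinv K (njobs I) <=
    eps * work_price Pinv K 1 / 4 * wtot I.
  apply: le_trans many; rewrite ler_wpM2l ?mulr_ge0 ?wmax_ge0//.
  by apply: (marginal_le_Delta P Pinv hP); rewrite divr_gt0// ltr0n.
have := ler_wpM2l (ltW eps0) LB; rewrite mulrA => epsLB.
have := ler_wpM2r cb0 C2; rewrite -EFinM lee_fin => C2cb.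
by rewrite [leRHS]mulrDl; move: wJ epsLB C2cb; lra.
Qed.
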